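(* Let $A$ and $B$ be diassociative algebras over a field $\mathbb{F}$ with $A$ abelian, and let $(\varphi_{\dashv},\varphi_{\vdash},\varphi_{\dashv}',\varphi_{\vdash}',f_{\dashv},f_{\vdash})$ be a factor system of $A$ by $B$. Then $(\varphi_{\dashv},\varphi_{\vdash},\varphi_{\dashv}',\varphi_{\vdash}',f_{\dashv},f_{\vdash})$ is central if and only if $\varphi_{\dashv}$, $\varphi_{\vdash}$, $\varphi_{\dashv}'$ and $\varphi_{\vdash}'$ are all zero.
   Context: All algebras are vector spaces over a fixed field $\mathbb{F}$. A diassociative algebra is a vector space with two associative bilinear products $\dashv,\vdash$ satisfying, for all $x,y,z$: (D1) $x\dashv(y\dashv z)=x\dashv(y\vdash z)$; (D2) $(x\vdash y)\dashv z=x\vdash(y\dashv z)$; (D3) $(x\dashv y)\vdash z=(x\vdash y)\vdash z$. It is abelian if both products are zero. The center of $L$ is $Z(L)=\{z\in L: z\dashv x=x\dashv z=z\vdash x=x\vdash z=0\text{ for all }x\in L\}$. Homomorphisms are linear maps preserving both products. $\mathcal{L}(A)$ is the space of linear maps $A\to A$. A factor system of $A$ by $B$ is a tuple $(\varphi_{\dashv},\varphi_{\vdash},\varphi_{\dashv}',\varphi_{\vdash}',f_{\dashv},f_{\vdash})$ with $\varphi_{\dashv},\varphi_{\vdash},\varphi_{\dashv}',\varphi_{\vdash}':B\to\mathcal{L}(A)$ linear and $f_{\dashv},f_{\vdash}:B\times B\to A$ bilinear such that for all $m,n,p\in A$, $i,j,k\in B$: 1. (a) $m\dashv(\varphi_{\dashv}(j)p)=m\dashv(\varphi_{\vdash}(j)p)$;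 (b) $m\dashv(\varphi_{\dashv}'(k)n)=m\dashv(\varphi_{\vdash}'(k)n)$; (c) $m\dashv f_{\dashv}(j,k)+\varphi_{\dashv}'(j\dashv k)m=m\dashv f_{\vdash}(j,k)+\varphi_{\dashv}'(j\vdash k)m$; (d) $\varphi_{\dashv}(i)(n\dashv p)=\varphi_{\dashv}(i)(n\vdash p)$; (e) $\varphi_{\dashv}(i)(\varphi_{\dashv}(j)p)=\varphi_{\dashv}(i)(\varphi_{\vdash}(j)p)$; (f) $\varphi_{\dashv}(i)(\varphi_{\dashv}'(k)n)=\varphi_{\dashv}(i)(\varphi_{\vdash}'(k)n)$; (g) $\varphi_{\dashv}(i)f_{\dashv}(j,k)+f_{\dashv}(i,j\dashv k)=\varphi_{\dashv}(i)f_{\vdash}(j,k)+f_{\dashv}(i,j\vdash k)$. 2. (a) $(\varphi_{\vdash}(i)n)\dashv p=\varphi_{\vdash}(i)(n\dashv p)$; (b) $(\varphi_{\vdash}'(j)m)\dashv p=m\vdash(\varphi_{\dashv}(j)p)$; (c) $f_{\vdash}(i,j)\dashv p+\varphi_{\dashv}(i\vdash j)p=\varphi_{\vdash}(i)(\varphi_{\dashv}(j)p)$; (d) $\varphi_{\dashv}'(k)(m\vdash n)=m\vdash(\varphi_{\dashv}'(k)n)$; (e) $\varphi_{\dashv}'(k)(\varphi_{\vdash}(i)n)=\varphi_{\vdash}(i)(\varphi_{\dashv}'(k)n)$; (f) $\varphi_{\dashv}'(k)(\varphi_{\vdash}'(j)m)=\varphi_{\vdash}'(j\dashv k)m+m\vdash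 f_{\dashv}(j,k)$; (g) $\varphi_{\dashv}'(k)f_{\vdash}(i,j)+f_{\dashv}(i\vdash j,k)=\varphi_{\vdash}(i)f_{\dashv}(j,k)+f_{\vdash}(i,j\dashv k)$. 3. (a) $(\varphi_{\dashv}(i)n)\vdash p=(\varphi_{\vdash}(i)n)\vdash p$; (b) $(\varphi_{\dashv}'(j)m)\vdash p=(\varphi_{\vdash}'(j)m)\vdash p$; (c) $f_{\dashv}(i,j)\vdash p+\varphi_{\vdash}(i\dashv j)p=f_{\vdash}(i,j)\vdash p+\varphi_{\vdash}(i\vdash j)p$; (d) $\varphi_{\vdash}'(k)(m\dashv n)=\varphi_{\vdash}'(k)(m\vdash n)$; (e) $\varphi_{\vdash}'(k)(\varphi_{\dashv}(i)n)=\varphi_{\vdash}'(k)(\varphi_{\vdash}(i)n)$; (f) $\varphi_{\vdash}'(k)(\varphi_{\dashv}'(j)m)=\varphi_{\vdash}'(k)(\varphi_{\vdash}'(j)m)$; (g) $\varphi_{\vdash}'(k)f_{\dashv}(i,j)+f_{\vdash}(i\dashv j,k)=\varphi_{\vdash}'(k)f_{\vdash}(i,j)+f_{\vdash}(i\vdash j,k)$. 4. (a) $m\dashv(\varphi_{\dashv}(j)p)=(\varphi_{\dashv}'(j)m)\dashv p$; (b) $m\dashv(\varphi_{\dashv}'(k)n)=\varphi_{\dashv}'(k)(m\dashv n)$; (c) $m\dashv f_{\dashv}(j,k)+\varphi_{\dashv}'(j\dashv k)m=\varphi_{\dashv}'(k)(\varphi_{\dashv}'(j)m)$; (d) $\varphi_{\dashv}(i)(n\dashv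 p)=(\varphi_{\dashv}(i)n)\dashv p$; (e) $\varphi_{\dashv}(i)(\varphi_{\dashv}(j)p)=\varphi_{\dashv}(i\dashv j)p+f_{\dashv}(i,j)\dashv p$; (f) $\varphi_{\dashv}(i)(\varphi_{\dashv}'(k)n)=\varphi_{\dashv}'(k)(\varphi_{\dashv}(i)n)$; (g) $\varphi_{\dashv}(i)f_{\dashv}(j,k)+f_{\dashv}(i,j\dashv k)=\varphi_{\dashv}'(k)f_{\dashv}(i,j)+f_{\dashv}(i\dashv j,k)$. 5. The identities obtained from 4(a)–(g) by replacing every $\dashv$ (including in subscripts) by $\vdash$. An extension of $A$ by $B$ is a short exact sequence $0\to A\xrightarrow{\sigma}L\xrightarrow{\pi}B\to0$ with $L$ a diassociative algebra and $\sigma,\pi$ homomorphisms; it is central if $\sigma(A)\subseteq Z(L)$. A section is a linear map $T:B\to L$ with $\pi T=I_B$. For $x\in L$, $m\in A$ put $P_{\dashv}(x)m=\sigma^{-1}(x\dashv\sigma(m))$, $P_{\dashv}'(x)m=\sigma^{-1}(\sigma(m)\dashv x)$, $P_{\vdash}(x)m=\sigma^{-1}(x\vdash\sigma(m))$, $P_{\vdash}'(x)m=\sigma^{-1}(\sigma(m)\vdash x)$. A factor system belongs to the extension and $T$ if $\varphi_{\dashv}=P_{\dashv}T$, $\varphi_{\vdash}=P_{\vdash}T$, $\varphi_{\dashv}'=P_{\dashv}'T$, $\varphi_{\vdash}'=P_{\vdash}'T$, $\sigma(f_{\dashv}(i,j))=T(i)\dashv T(j)-T(i\dashv j)$ and $\sigma(f_{\vdash}(i,j))=T(i)\vdash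 T(j)-T(i\vdash j)$ for all $i,j\in B$. A factor system is central if it belongs to a central extension (and some section). *)

(* Defs.v *)
From HB Require Import structures.
From mathcomp Require Import all_boot all_order all_algebra.

Set Implicit Arguments.
Unset Strict Implicit.
Unset Printing Implicit Defensive.

Import GRing.Theory.

Local Open Scope ring_scope.

Declare Scope diassoc_scope.
Delimit Scope diassoc_scope with dias.

Reserved Notation "x ⊣ y" (at level 40, left associativity).
Reserved Notation "x ⊢ y" (at level 40, left associativity).

HB.mixin Record isDiassociative (F : fieldType) L of GRing.Lmodule F L := {
  ldprod : {bilinear L -> L -> L};
  rdprod : {bilinear L -> L -> L};
  ldprodA : forall x y z, ldprod x (ldprod y z) = ldprod (ldprod x y) z;
  rdprodA : forall x y z, rdprod x (rdprod y z) = rdprod (rdprod x y) z;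
  diass1 : forall x y z, ldprod x (ldprod y z) = ldprod x (rdprod y z);
  diass2 : forall x y z, ldprod (rdprod x y) z = rdprod x (ldprod y z);
  diass3 : forall x y z, rdprod (ldprod x y) z = rdprod (rdprod x y) z
}.

#[short(type="diassAlgType")]
HB.structure Definition Diassociative (F : fieldType) :=
  {L of GRing.Lmodule F L & isDiassociative F L}.

Notation "x ⊣ y" := (ldprod x y) : diassoc_scope.
Notation "x ⊢ y" := (rdprod x y) : diassoc_scope.

Local Open Scope diassoc_scope.

Section Basics.
Variables (F : fieldType) (L M : diassAlgType F).

Definition abelian_diass : Prop := forall x y : L, x ⊣ y = 0 /\ x ⊢ y = 0.

Definition in_center (z : L) : Prop :=
  forall x : L, [/\ z ⊣ x = 0, x ⊣ z = 0, z ⊢ x = 0 & x ⊢ z = 0].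

Definition diass_hom (h : {linear L -> M}) : Prop :=
  forall x y : L, h (x ⊣ y) = h x ⊣ h y /\ h (x ⊢ y) = h x ⊢ h y.

End Basics.

Arguments abelian_diass {F} L.

(* A linear map B -> L(A) is given in curried form, as a bilinear map
   B -> A -> A: MathComp has no module structure on {linear A -> A}.
   The maps written with a prime in the literature are phil' and phir'. *)
Record factor_system (F : fieldType) (A B : diassAlgType F) := FactorSystem {
  phil : {bilinear B -> A -> A};
  phir : {bilinear B -> A -> A};
  phil' : {bilinear B -> A -> A};
  phir' : {bilinear B -> A -> A};
  fl : {bilinear B -> B -> A};
  fr : {bilinear B -> B -> A};

  fs1a : forall (m p : A) (j : B), m ⊣ phil j p = m ⊣ phir j p;
  fs1b : forall (m n : A) (k : B), m ⊣ phil' k n = m ⊣ phir' k n;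
  fs1c : forall (m : A) (j k : B),
    m ⊣ fl j k + phil' (j ⊣ k) m = m ⊣ fr j k + phil' (j ⊢ k) m;
  fs1d : forall (n p : A) (i : B), phil i (n ⊣ p) = phil i (n ⊢ p);
  fs1e : forall (p : A) (i j : B), phil i (phil j p) = phil i (phir j p);
  fs1f : forall (n : A) (i k : B), phil i (phil' k n) = phil i (phir' k n);
  fs1g : forall i j k : B,
    phil i (fl j k) + fl i (j ⊣ k) = phil i (fr j k) + fl i (j ⊢ k);

  fs2a : forall (n p : A) (i : B), phir i n ⊣ p = phir i (n ⊣ p);
  fs2b : forall (m p : A) (j : B), phir' j m ⊣ p = m ⊢ phil j p;
  fs2c : forall (p : A) (i j : B),
    fr i j ⊣ p + phil (i ⊢ j) p = phir i (phil j p);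
  fs2d : forall (m n : A) (k : B), phil' k (m ⊢ n) = m ⊢ phil' k n;
  fs2e : forall (n : A) (i k : B), phil' k (phir i n) = phir i (phil' k n);
  fs2f : forall (m : A) (j k : B),
    phil' k (phir' j m) = phir' (j ⊣ k) m + m ⊢ fl j k;
  fs2g : forall i j k : B,
    phil' k (fr i j) + fl (i ⊢ j) k = phir i (fl j k) + fr i (j ⊣ k);

  fs3a : forall (n p : A) (i : B), phil i n ⊢ p = phir i n ⊢ p;
  fs3b : forall (m p : A) (j : B), phil' j m ⊢ p = phir' j m ⊢ p;
  fs3c : forall (p : A) (i j : B),
    fl i j ⊢ p + phir (i ⊣ j) p = fr i j ⊢ p + phir (i ⊢ j) p;
  fs3d : forall (m n : A) (k : B), phir' k (m ⊣ n) = phir' k (m ⊢ n);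
  fs3e : forall (n : A) (i k : B), phir' k (phil i n) = phir' k (phir i n);
  fs3f : forall (m : A) (j k : B), phir' k (phil' j m) = phir' k (phir' j m);
  fs3g : forall i j k : B,
    phir' k (fl i j) + fr (i ⊣ j) k = phir' k (fr i j) + fr (i ⊢ j) k;

  fs4a : forall (m p : A) (j : B), m ⊣ phil j p = phil' j m ⊣ p;
  fs4b : forall (m n : A) (k : B), m ⊣ phil' k n = phil' k (m ⊣ n);
  fs4c : forall (m : A) (j k : B),
    m ⊣ fl j k + phil' (j ⊣ k) m = phil' k (phil' j m);
  fs4d : forall (n p : A) (i : B), phil i (n ⊣ p) = phil i n ⊣ p;
  fs4e : forall (p : A) (i j : B),
    phil i (phil j p) = phil (i ⊣ j) p + fl i j ⊣ p;
  fs4f : forall (n : A) (i k : B), phil i (phil' k n) = phil' k (phil i n);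
  fs4g : forall i j k : B,
    phil i (fl j k) + fl i (j ⊣ k) = phil' k (fl i j) + fl (i ⊣ j) k;

  fs5a : forall (m p : A) (j : B), m ⊢ phir j p = phir' j m ⊢ p;
  fs5b : forall (m n : A) (k : B), m ⊢ phir' k n = phir' k (m ⊢ n);
  fs5c : forall (m : A) (j k : B),
    m ⊢ fr j k + phir' (j ⊢ k) m = phir' k (phir' j m);
  fs5d : forall (n p : A) (i : B), phir i (n ⊢ p) = phir i n ⊢ p;
  fs5e : forall (p : A) (i j : B),
    phir i (phir j p) = phir (i ⊢ j) p + fr i j ⊢ p;
  fs5f : forall (n : A) (i k : B), phir i (phir' k n) = phir' k (phir i n);
  fs5g : forall i j k : B,
    phir i (fr j k) + fr i (j ⊢ k) = phir' k (fr i j) + fr (i ⊢ j) k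
}.

Record extension (F : fieldType) (A B : diassAlgType F) := Extension {
  ext_alg :> diassAlgType F;
  ext_inj : {linear A -> ext_alg};
  ext_proj : {linear ext_alg -> B};
  ext_inj_hom : diass_hom ext_inj;
  ext_proj_hom : diass_hom ext_proj;
  ext_injP : injective ext_inj;
  ext_projP : forall b : B, exists x : ext_alg, ext_proj x = b;
  ext_exact : forall x : ext_alg, ext_proj x = 0 <-> exists m : A, ext_inj m = x
}.

Section Extensions.
Variables (F : fieldType) (A B : diassAlgType F).
Implicit Types E : extension A B.

Definition central_extension E : Prop := forall m : A, in_center (ext_inj E m).

Definition is_section E (T : {linear B -> E}) : Prop :=
  forall b : B, ext_proj E (T b) = b.

Lemma ext_inj_onto_ker E (y : E) :
  ext_proj E y = 0 -> exists m : A, ext_inj E m == y.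
Proof. by move=> /ext_exact[m <-]; exists m. Qed.

(* The inverse of sigma on its image, which is the kernel of pi. *)
Definition ext_inj_inv E (y : E) (y_ker : ext_proj E y = 0) : A :=
  xchoose (ext_inj_onto_ker y_ker).

Lemma ext_inj_invK E (y : E) (y_ker : ext_proj E y = 0) :
  ext_inj E (ext_inj_inv y_ker) = y.
Proof. exact/eqP/(xchooseP (ext_inj_onto_ker y_ker)). Qed.

Lemma ext_proj_inj E (m : A) : ext_proj E (ext_inj E m) = 0.
Proof. by apply/ext_exact; exists m. Qed.

Lemma ker_Pl E (x : E) (m : A) : ext_proj E (x ⊣ ext_inj E m) = 0.
Proof. by rewrite (ext_proj_hom _ _).1 ext_proj_inj linear0r. Qed.

Lemma ker_Pl' E (x : E) (m : A) : ext_proj E (ext_inj E m ⊣ x) = 0.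
Proof. by rewrite (ext_proj_hom _ _).1 ext_proj_inj linear0l. Qed.

Lemma ker_Pr E (x : E) (m : A) : ext_proj E (x ⊢ ext_inj E m) = 0.
Proof. by rewrite (ext_proj_hom _ _).2 ext_proj_inj linear0r. Qed.

Lemma ker_Pr' E (x : E) (m : A) : ext_proj E (ext_inj E m ⊢ x) = 0.
Proof. by rewrite (ext_proj_hom _ _).2 ext_proj_inj linear0l. Qed.

Definition Pl E (x : E) (m : A) : A := ext_inj_inv (ker_Pl x m).
Definition Pl' E (x : E) (m : A) : A := ext_inj_inv (ker_Pl' x m).
Definition Pr E (x : E) (m : A) : A := ext_inj_inv (ker_Pr x m).
Definition Pr' E (x : E) (m : A) : A := ext_inj_inv (ker_Pr' x m).

Definition belongs_to (S : factor_system A B) E (T : {linear B -> E}) : Prop :=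
  [/\ forall (i : B) (m : A), phil S i m = Pl (T i) m /\ phir S i m = Pr (T i) m,
      forall (i : B) (m : A),
        phil' S i m = Pl' (T i) m /\ phir' S i m = Pr' (T i) m,
      forall i j : B, ext_inj E (fl S i j) = T i ⊣ T j - T (i ⊣ j) &
      forall i j : B, ext_inj E (fr S i j) = T i ⊢ T j - T (i ⊢ j)].

Definition central_factor_system (S : factor_system A B) : Prop :=
  exists (E : extension A B) (T : {linear B -> E}),
    [/\ central_extension E, is_section T & belongs_to S T].

End Extensions.

(* Main.v *)
Require Import Defs.
From HB Require Import structures.
From mathcomp Require Import all_boot all_order all_algebra.

(** An extension [E] of an abelian [A] by [B] with section [T] is, as a vector
    space, the sum of [T B] and [sigma A].  The products of two elements of
    [sigma A] vanish, so the elements of [sigma A] are central as soon as they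
    have zero products with [T B]; these products are, through the injective
    [sigma], the values of the four action maps of any factor system that
    belongs to [E] and [T].  Hence such a factor system has zero actions
    exactly when [E] is central ([central_extensionP]).

    It remains to know that every factor system belongs to some extension.
    This is the crossed product: [A * B] with products
      (m, i) (n, j) = (m n + phi i n + phi' j m + f i j, i j)
    and section [i |-> (0, i)] ([belongs_to_crossed_extension]).  Each axiom of
    diassociative algebras compares two triple products; expanded, the
    [A]-component of a triple product splits into eight groups according to
    which of the three factors contribute their [A]-part
    ([crossed_prodA_right], [crossed_prodA_left]).  The group using all three
    agrees by the axiom in [A], and the other seven by the seven identities of
    the corresponding family among [fs1a]-[fs5g]. *)

Set Implicit Arguments.
Unset Strict Implicit.
Unset Printing Implicit Defensive.

Import GRing.Theory.

Local Open Scope ring_scope.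
Local Open Scope diassoc_scope.

Section CrossedProduct.
Variables (F : fieldType) (A B : lmodType F).

(** The shape common to both products of the crossed product; the left and
    right data are plugged in later, so that bilinearity and the expansion of
    triple products are settled once for all combinations of the two. *)
Definition crossed_prod (mA : {bilinear A -> A -> A})
    (mB : {bilinear B -> B -> B}) (phi phi' : {bilinear B -> A -> A})
    (f : {bilinear B -> B -> A}) (x y : A * B) : A * B :=
  (mA x.1 y.1 + phi x.2 y.1 + phi' y.2 x.1 + f x.2 y.2, mB x.2 y.2).

Lemma crossed_prod_bilinear mA mB phi phi' f :
  bilinear_for *:%R *:%R (crossed_prod mA mB phi phi' f).
Proof.
split=> z a x y; congr pair; rewrite /= ?linearPr ?linearPl //=;
  by rewrite !scalerDr [LHS](AC (2*2*2*2) ((1*3*5*7)*(2*4*6*8))).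
Qed.

HB.instance Definition _ mA mB phi phi' f :=
  bilinear_isBilinear.Build F (A * B)%type (A * B)%type (A * B)%type *:%R *:%R
    (crossed_prod mA mB phi phi' f) (crossed_prod_bilinear mA mB phi phi' f).

Variables (mA1 mA2 : {bilinear A -> A -> A}) (mB1 mB2 : {bilinear B -> B -> B}).
Variables (phi1 phi1' phi2 phi2' : {bilinear B -> A -> A}).
Variables (f1 f2 : {bilinear B -> B -> A}).
Local Notation mul1 := (crossed_prod mA1 mB1 phi1 phi1' f1).
Local Notation mul2 := (crossed_prod mA2 mB2 phi2 phi2' f2).

(** The summands are listed in the order in which each family [fs1a]-[fs1g], ...,
    [fs5a]-[fs5g] treats them, so that an axiom is verified by rewriting
    termwise. *)
Lemma crossed_prodA_right (m n p : A) (i j k : B) :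
  mul1 (m, i) (mul2 (n, j) (p, k)) =
  (mA1 m (mA2 n p) + mA1 m (phi2 j p) + mA1 m (phi2' k n)
   + (mA1 m (f2 j k) + phi1' (mB2 j k) m) + phi1 i (mA2 n p)
   + phi1 i (phi2 j p) + phi1 i (phi2' k n)
   + (phi1 i (f2 j k) + f1 i (mB2 j k)),
   mB1 i (mB2 j k)).
Proof.
rewrite {1}/crossed_prod /= !linearDr /=; congr pair.
by rewrite [LHS](AC (4*4*1*1) (1*2*3*(4*9)*5*6*7*(8*10))).
Qed.

Lemma crossed_prodA_left (m n p : A) (i j k : B) :
  mul1 (mul2 (m, i) (n, j)) (p, k) =
  (mA1 (mA2 m n) p + mA1 (phi2' j m) p + phi1' k (mA2 m n)
   + phi1' k (phi2' j m) + mA1 (phi2 i n) p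
   + (mA1 (f2 i j) p + phi1 (mB2 i j) p) + phi1' k (phi2 i n)
   + (phi1' k (f2 i j) + f1 (mB2 i j) k),
   mB1 (mB2 i j) k).
Proof.
rewrite {1}/crossed_prod /= !linearDl !linearDr /=; congr pair.
by rewrite [LHS](AC (4*1*4*1) (1*3*6*8*2*(4*5)*7*(9*10))).
Qed.

End CrossedProduct.

(** The argument [S] keeps apart the types on which the algebra structures of
    different factor systems are declared. *)
Definition crossed_of (F : fieldType) (A B : diassAlgType F)
  (S : factor_system A B) : Type := (A * B)%type.

Section CrossedExtension.
Variables (F : fieldType) (A B : diassAlgType F) (S : factor_system A B).
Local Notation crossed := (crossed_of S).

HB.instance Definition _ := GRing.Lmodule.copy crossed (A * B)%type.

Definition crossed_l : {bilinear crossed -> crossed -> crossed} :=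
  crossed_prod (@ldprod F A) (@ldprod F B) (phil S) (phil' S) (fl S).
Definition crossed_r : {bilinear crossed -> crossed -> crossed} :=
  crossed_prod (@rdprod F A) (@rdprod F B) (phir S) (phir' S) (fr S).

Lemma crossed_lA x y z :
  crossed_l x (crossed_l y z) = crossed_l (crossed_l x y) z.
Proof.
case: x y z => [m i] [n j] [p k].
rewrite [LHS]crossed_prodA_right [RHS]crossed_prodA_left !ldprodA.
by rewrite fs4a fs4b fs4c fs4d fs4e fs4f fs4g [fl S i j ⊣ p + _]addrC.
Qed.

Lemma crossed_rA x y z :
  crossed_r x (crossed_r y z) = crossed_r (crossed_r x y) z.
Proof.
case: x y z => [m i] [n j] [p k].
rewrite [LHS]crossed_prodA_right [RHS]crossed_prodA_left !rdprodA.
by rewrite fs5a fs5b fs5c fs5d fs5e fs5f fs5g [fr S i j ⊢ p + _]addrC.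
Qed.

Lemma crossed_diass1 x y z :
  crossed_l x (crossed_l y z) = crossed_l x (crossed_r y z).
Proof.
case: x y z => [m i] [n j] [p k].
rewrite [LHS]crossed_prodA_right [RHS]crossed_prodA_right !diass1.
by rewrite fs1a fs1b fs1c fs1d fs1e fs1f fs1g.
Qed.

Lemma crossed_diass2 x y z :
  crossed_l (crossed_r x y) z = crossed_r x (crossed_l y z).
Proof.
case: x y z => [m i] [n j] [p k].
rewrite [LHS]crossed_prodA_left [RHS]crossed_prodA_right !diass2.
by rewrite fs2a fs2b fs2c fs2d fs2e fs2f fs2g [m ⊢ fl S j k + _]addrC.
Qed.

Lemma crossed_diass3 x y z :
  crossed_r (crossed_l x y) z = crossed_r (crossed_r x y) z.
Proof.
case: x y z => [m i] [n j] [p k].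
rewrite [LHS]crossed_prodA_left [RHS]crossed_prodA_left !diass3.
by rewrite fs3a fs3b fs3c fs3d fs3e fs3f fs3g.
Qed.

HB.instance Definition _ := isDiassociative.Build F crossed
  crossed_lA crossed_rA crossed_diass1 crossed_diass2 crossed_diass3.

Definition crossed_inj (m : A) : crossed := (m, 0).
Definition crossed_proj (x : crossed) : B := x.2.
Definition crossed_section (i : B) : crossed := (0, i).

Lemma crossed_inj_linear : linear crossed_inj.
Proof. by move=> a m n; congr pair; rewrite /= scaler0 addr0. Qed.

Lemma crossed_proj_linear : linear crossed_proj.
Proof. by []. Qed.

Lemma crossed_section_linear : linear crossed_section.
Proof. by move=> a i j; congr pair; rewrite /= scaler0 addr0. Qed.

HB.instance Definition _ :=
  GRing.isLinear.Build F A crossed _ crossed_inj crossed_inj_linear.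
HB.instance Definition _ :=
  GRing.isLinear.Build F crossed B _ crossed_proj crossed_proj_linear.
HB.instance Definition _ :=
  GRing.isLinear.Build F B crossed _ crossed_section crossed_section_linear.

Lemma crossed_inj_hom : diass_hom crossed_inj.
Proof.
by move=> m n; split; congr pair; rewrite /= ?linear0l ?addr0 ?linear0l.
Qed.

Lemma crossed_proj_hom : diass_hom crossed_proj.
Proof. by []. Qed.

Lemma crossed_inj_injective : injective crossed_inj.
Proof. by move=> m n []. Qed.

Lemma crossed_proj_onto b : exists x, crossed_proj x = b.
Proof. by exists (0, b). Qed.

Lemma crossed_exact x :
  crossed_proj x = 0 <-> exists m, crossed_inj m = x.
Proof. by case: x => m i; split=> [/= -> | [n [_ <-]]] //; exists m. Qed.

Definition crossed_extension : extension A B :=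
  Extension crossed_inj_hom crossed_proj_hom crossed_inj_injective
    crossed_proj_onto crossed_exact.

End CrossedExtension.

Arguments crossed_section {F A B} S i.

Section Belonging.
Variables (F : fieldType) (A B : diassAlgType F).
Implicit Types (S : factor_system A B) (E : extension A B).

Lemma ext_inj_Pl E (x : E) m : ext_inj E (Pl x m) = x ⊣ ext_inj E m.
Proof. exact: ext_inj_invK. Qed.

Lemma ext_inj_Pl' E (x : E) m : ext_inj E (Pl' x m) = ext_inj E m ⊣ x.
Proof. exact: ext_inj_invK. Qed.

Lemma ext_inj_Pr E (x : E) m : ext_inj E (Pr x m) = x ⊢ ext_inj E m.
Proof. exact: ext_inj_invK. Qed.

Lemma ext_inj_Pr' E (x : E) m : ext_inj E (Pr' x m) = ext_inj E m ⊢ x.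
Proof. exact: ext_inj_invK. Qed.

(** In the crossed product (0, i) (m, 0) = (phi i m, 0),
    (m, 0) (0, i) = (phi' i m, 0) and (0, i) (0, j) = (f i j, i j), all the
    other terms of the product formula being killed by bilinearity. *)
Lemma belongs_to_crossed_extension S :
  belongs_to S (crossed_section S : {linear B -> crossed_extension S}).
Proof.
split=> [i m | i m | i j | i j].
- split; apply: (@ext_injP _ _ _ (crossed_extension S)).
    rewrite ext_inj_Pl; congr pair; rewrite /= ?linear0r //.
    by rewrite !linear0l add0r !addr0.
  rewrite ext_inj_Pr; congr pair; rewrite /= ?linear0r //.
  by rewrite !linear0l add0r !addr0.
- split; apply: (@ext_injP _ _ _ (crossed_extension S)).
    rewrite ext_inj_Pl'; congr pair; rewrite /= ?linear0l //.
    by rewrite !linear0r !add0r addr0.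
  rewrite ext_inj_Pr'; congr pair; rewrite /= ?linear0l //.
  by rewrite !linear0r !add0r addr0.
- by congr pair; rewrite /= ?subrr // !linear0r !add0r subr0.
- by congr pair; rewrite /= ?subrr // !linear0r !add0r subr0.
Qed.

Lemma section_decomp E (T : {linear B -> E}) (x : E) :
  is_section T -> exists a, x = T (ext_proj E x) + ext_inj E a.
Proof.
move=> secT; have /ext_exact[a aE]: ext_proj E (x - T (ext_proj E x)) = 0.
  by rewrite linearB /= secT subrr.
by exists a; rewrite aE addrC subrK.
Qed.

(** Centrality tests [sigma m] against all of [E], the actions test it only
    against [T B]; since [E] is the sum of [T B] and [sigma A], the difference
    consists of products within [sigma A], which vanish for abelian [A]. *)
Lemma central_extensionP S E (T : {linear B -> E}) :
    abelian_diass A -> is_section T -> belongs_to S T ->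
  central_extension E <->
  [/\ forall i m, phil S i m = 0, forall i m, phir S i m = 0,
      forall i m, phil' S i m = 0 & forall i m, phir' S i m = 0].
Proof.
move=> abA secT [phiP phiP' _ _]; split=> [cE | [l0 r0 l0' r0'] m x].
  split=> i m; apply: (@ext_injP _ _ _ E); rewrite linear0;
    have [zl' zl zr' zr] := cE m (T i).
  - by rewrite (phiP i m).1 ext_inj_Pl.
  - by rewrite (phiP i m).2 ext_inj_Pr.
  - by rewrite (phiP' i m).1 ext_inj_Pl'.
  - by rewrite (phiP' i m).2 ext_inj_Pr'.
have [a ->] := section_decomp x secT; set i := ext_proj E x.
have injM b c : ext_inj E b ⊣ ext_inj E c = 0 /\ ext_inj E b ⊢ ext_inj E c = 0.
  by rewrite -(ext_inj_hom E b c).1 -(ext_inj_hom E b c).2 (abA b c).1 (abA b c).2 linear0.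
split; rewrite ?linearDl ?linearDr /= ?(injM _ _).1 ?(injM _ _).2 addr0.
- by rewrite -ext_inj_Pl' -(phiP' i m).1 l0' linear0.
- by rewrite -ext_inj_Pl -(phiP i m).1 l0 linear0.
- by rewrite -ext_inj_Pr' -(phiP' i m).2 r0' linear0.
- by rewrite -ext_inj_Pr -(phiP i m).2 r0 linear0.
Qed.

End Belonging.

Theorem theorem4p9 (F : fieldType) (A B : diassAlgType F)
    (S : factor_system A B) (hA : abelian_diass A) :
  central_factor_system S <->
  [/\ forall (i : B) (m : A), phil S i m = 0,
      forall (i : B) (m : A), phir S i m = 0,
      forall (i : B) (m : A), phil' S i m = 0 &
      forall (i : B) (m : A), phir' S i m = 0].
Proof.
split=> [[E [T [cE secT STbel]]] | phi0].
  exact/(central_extensionP hA secT STbel).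
have secT : is_section (crossed_section S : {linear B -> crossed_extension S}).
  by [].
have STbel := belongs_to_crossed_extension S.
exists (crossed_extension S), (crossed_section S); split=> //.
exact/(central_extensionP hA secT STbel).
Qed.
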